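(* Let $m_2<m_1$ be nonnegative integers. If $p=m_1+m_2+2$, then $M_{p,m_1,m_2}(a,b)=\dfrac{a+b}{2}$ for all $a,b>0$.
   Context: Let $m_2<m_1$ be nonnegative integers and $n=m_1+m_2+1$. For $f\in C^{n+2}(0,\infty)$ with $f^{(n+1)}$ nowhere zero and $0<a<b$, let $P,Q$ be the unique polynomials of degree at most $n$ with $P^{(j)}(a)=f^{(j)}(a)$ for $0\le j\le m_1$, $P^{(j)}(b)=f^{(j)}(b)$ for $0\le j\le m_2$, and $Q^{(j)}(a)=f^{(j)}(a)$ for $0\le j\le m_2$, $Q^{(j)}(b)=f^{(j)}(b)$ for $0\le j\le m_1$. The equation $f(x)-P(x)=(-1)^{m_1-m_2}\,(f(x)-Q(x))$ has exactly one solution $x\in(a,b)$, and this solution is denoted $M_{f,m_1,m_2}(a,b)$. One extends the definition by $M_{f,m_1,m_2}(b,a)=M_{f,m_1,m_2}(a,b)$ and $M_{f,m_1,m_2}(a,a)=a$. For real $p\notin\{0,1,\dots,n\}$, $M_{p,m_1,m_2}$ denotes $M_{f,m_1,m_2}$ with $f(x)=x^p$. *)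

(* Defs.v *)
From HB Require Import structures.
From mathcomp Require Import all_boot all_order all_algebra.
From mathcomp Require Import all_classical all_reals all_analysis.

Set Implicit Arguments.
Unset Strict Implicit.
Unset Printing Implicit Defensive.

Import Order.TTheory GRing.Theory Num.Theory.
Import numFieldNormedType.Exports.

Local Open Scope classical_set_scope.
Local Open Scope ring_scope.

Section TwoPointMean.
Variable R : realType.
Implicit Types (f : R -> R) (a b x p : R) (k l : nat) (P : {poly R}).

(* P has degree at most n = k + l + 1 (so size at most n + 1), agrees with f
   to order k at a and to order l at b. *)
Definition is_hermite f a k b l P : Prop :=
  [/\ (size P <= (k + l + 1).+1)%N,
      (forall j, (j <= k)%N -> (derivn j P).[a] = derive1n j f a)
    & (forall j, (j <= l)%N -> (derivn j P).[b] = derive1n j f b)].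

(* For a != b there is exactly one such polynomial; the default value 0 only
   makes the operation total. *)
Definition hermite f a k b l : {poly R} :=
  xget 0 [set P | is_hermite f a k b l P].

Definition mean_equation f (m1 m2 : nat) a b x : Prop :=
  f x - (hermite f a m1 b m2).[x] =
  (-1) ^+ (m1 - m2)%N * (f x - (hermite f a m2 b m1).[x]).

(* Meaningful for m2 < m1 and 0 < a < b, when f is C^(n+2) on ]0, +oo[ with
   f^(n+1) nowhere zero, n = m1 + m2 + 1: the equation then has exactly one
   solution in ]a, b[. The default value 0 lies outside ]a, b[. *)
Definition mean_lt f (m1 m2 : nat) a b : R :=
  xget 0 [set x | a < x < b /\ mean_equation f m1 m2 a b x].

Definition mean f (m1 m2 : nat) a b : R :=
  if a < b then mean_lt f m1 m2 a b
  else if b < a then mean_lt f m1 m2 b a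
  else a.

(* Intended for p outside {0, 1, ..., m1 + m2 + 1}; powR is the real power on
   ]0, +oo[, and only its values and derivatives there are used. *)
Definition power_mean p (m1 m2 : nat) a b : R :=
  mean (fun x => powR x p) m1 m2 a b.

End TwoPointMean.

(* Main.v *)
(* The Hermite interpolants of x^(n+1) at degree n are explicit: the error
   x^(n+1) - P(x) is a monic polynomial of degree n+1 with zeros of order m1+1
   at a and m2+1 at b, so it equals (x - a)^(m1+1) (x - b)^(m2+1), and
   symmetrically for Q. Dividing the mean equation by the common factor
   ((x - a) (x - b))^(m2+1) leaves (x - a)^(m1-m2) = (b - x)^(m1-m2), whose
   only solution in ]a, b[ is the midpoint. *)

Require Import Defs.
From mathcomp Require Import all_boot all_order all_algebra.
From mathcomp Require Import all_classical all_reals all_analysis.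
From mathcomp Require Import lra zify.
Import Order.TTheory GRing.Theory Num.Theory.
Local Open Scope ring_scope.

(** One derivation lowers the exponent by one and only changes the cofactor, so the inductions below
    run over all [r]. *)
Lemma deriv_expXsubCM (R : comNzRingType) (a : R) (m : nat) (r : {poly R}) :
  deriv (('X - a%:P) ^+ m.+1 * r) =
  ('X - a%:P) ^+ m * (r *+ m.+1 + ('X - a%:P) * deriv r).
Proof.
rewrite derivM deriv_exp derivXsubC mul1r /= mulrDr exprSr.
by rewrite -mulrA mulrnAl mulrnAr.
Qed.

Lemma derivn_expXsubCM_lt (R : comNzRingType) (a : R) (m j : nat)
    (r : {poly R}) :
  (j < m)%N -> (derivn j (('X - a%:P) ^+ m * r)).[a] = 0.
Proof.
elim: j m r => [|j IH] [|m] r // ltjm.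
  by rewrite derivn0 exprS !hornerE subrr !mul0r.
by rewrite derivSn deriv_expXsubCM IH.
Qed.

Lemma derivn_expXsubCM (R : comNzRingType) (a : R) (m : nat) (r : {poly R}) :
  (derivn m (('X - a%:P) ^+ m * r)).[a] = r.[a] *+ m`!.
Proof.
elim: m r => [|m IH] r; first by rewrite derivn0 expr0 mul1r.
rewrite derivSn deriv_expXsubCM IH.
by rewrite !hornerE subrr mul0r addr0 hornerMn -mulrnA factS.
Qed.

(** By induction [p] is [q] times the [m]-th power; its [m]-th derivative at [a] is then [m!] times
    [q.[a]], and [m!] is nonzero in characteristic 0, so [q] supplies one more factor. *)
Lemma dvdp_expXsubC_derivn (R : numFieldType) (a : R) (m : nat)
    (p : {poly R}) :
  (forall j, (j < m)%N -> (derivn j p).[a] = 0) -> ('X - a%:P) ^+ m %| p.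
Proof.
elim: m => [|m IH] p0; first by rewrite expr0 dvd1p.
have /dvdpP[q pq] : ('X - a%:P) ^+ m %| p.
  by apply: IH => j jm; apply: p0; exact: leqW.
have := p0 m (ltnSn m); rewrite {1}pq mulrC derivn_expXsubCM => /eqP.
rewrite mulrn_eq0 eqn0Ngt fact_gt0 /= => q0.
by rewrite pq exprS dvdp_mul ?dvdp_XsubCl.
Qed.

(** The difference of two interpolants is divisible by two coprime powers of total degree
    [k + l + 2], above its own degree bound, so it vanishes. *)
Lemma hermite_eq (R : realType) (f : R -> R) (a b : R) (k l : nat)
    (P : {poly R}) :
  a != b -> is_hermite f a k b l P -> hermite f a k b l = P.
Proof.
move=> ab hP; apply: xget_unique => // Q [sQ aQ bQ].
case: hP => sP aP bP; apply/eqP; rewrite -subr_eq0; apply/negPn/negP => D0.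
have : ('X - a%:P) ^+ k.+1 * ('X - b%:P) ^+ l.+1 %| Q - P.
  rewrite Gauss_dvdp; last first.
    rewrite coprimep_expl// coprimep_expr// coprimep_XsubC2//.
    by rewrite subr_eq0 eq_sym.
  by apply/andP; split; apply: dvdp_expXsubC_derivn => j jm;
    rewrite derivnB hornerD hornerN ?aQ ?aP ?bQ ?bP// subrr.
move=> /(dvdp_leq D0).
rewrite size_monicM ?monic_exp ?monicXsubC ?expf_neq0 ?polyXsubC_eq0//.
rewrite !size_exp_XsubC => sD.
have : (size (Q - P)%R <= (k + l + 1).+1)%N.
  by rewrite (leq_trans (size_polyD _ _))// geq_max size_polyN sQ.
by move/(leq_trans sD); lia.
Qed.

Lemma derive1n_powR_nat (R : realType) (n j : nat) (x : R) :
  0 < x -> derive1n j (fun y : R => powR y n%:R) x = (derivn j 'X^n).[x].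
Proof.
elim: j x => [|j IH] x x0.
  by rewrite derivn0 hornerXn derive1n0 powR_mulrn// ltW.
(* Positivity is an open condition, so the induction hypothesis holds near [x] and may be
   differentiated. *)
rewrite derive1nS derivnS derivE !derive1E; apply: near_eq_derive.
by near=> y; apply: IH; near: y; exact: lt_nbhsr.
Unshelve. all: by end_near. Qed.

Lemma size_subr_monic (R : nzRingType) (p q : {poly R}) (n : nat) :
  p \is monic -> q \is monic -> size p = n.+1 -> size q = n.+1 ->
  (size (p - q)%R <= n)%N.
Proof.
move=> /monicP + /monicP; rewrite /lead_coef => + + sp sq.
rewrite sp sq /= => pn qn; apply/leq_sizeP => j; rewrite leq_eqVlt coefB.
move=> /orP[/eqP <-|nj]; first by rewrite pn qn subrr.
by rewrite !nth_default ?sp ?sq// subrr.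
Qed.

Lemma hermite_powR_nat (R : realType) (k l : nat) (a b : R) :
  a != b -> 0 < a -> 0 < b ->
  hermite (fun y : R => powR y (k + l + 2)%:R) a k b l =
  'X^(k + l + 2) - ('X - a%:P) ^+ k.+1 * ('X - b%:P) ^+ l.+1.
Proof.
move=> ab a0 b0; apply: hermite_eq => //; split.
- apply: size_subr_monic; rewrite ?monicXn ?monicMl ?monic_exp ?monicXsubC//.
    by rewrite size_polyXn; lia.
  rewrite size_monicM ?monic_exp ?monicXsubC ?expf_neq0 ?polyXsubC_eq0//.
  by rewrite !size_exp_XsubC; lia.
- move=> j jk; rewrite derivnB hornerD hornerN derivn_expXsubCM_lt// subr0.
  by rewrite derive1n_powR_nat.
- move=> j jl; rewrite derivnB hornerD hornerN mulrC derivn_expXsubCM_lt//.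
  by rewrite subr0 derive1n_powR_nat.
Qed.

Lemma mean_equation_powR_nat (R : realType) (m1 m2 : nat) (a b x : R) :
  (m2 < m1)%N -> 0 < a -> a < x -> x < b ->
  mean_equation (fun y : R => powR y (m1 + m2 + 2)%:R) m1 m2 a b x <->
  x = (a + b) / 2.
Proof.
move=> m21 a0 ax xb; have ab : a < b by exact: lt_trans xb.
have b0 : 0 < b by exact: lt_trans ab.
have x0 : 0 < x by exact: lt_trans ax.
rewrite /mean_equation hermite_powR_nat ?lt_eqF//.
(* The orders are swapped in the second interpolant, so the exponent is reordered to match. *)
rewrite [in hermite _ a m2](addnC m1) hermite_powR_nat ?lt_eqF// (addnC m2).
rewrite powR_mulrn ?ltW// !hornerE !opprB.
rewrite !(addrC (x ^+ _) (_ - _)) !subrK.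
set d := (m1 - m2)%N; have -> : m1.+1 = (d + m2.+1)%N by rewrite /d; lia.
(* The sign is absorbed into the [d] surplus factors [x - b]. *)
have -> : (-1) ^+ d * ((x - a) ^+ m2.+1 * (x - b) ^+ (d + m2.+1)) =
    (b - x) ^+ d * ((x - a) ^+ m2.+1 * (x - b) ^+ m2.+1).
  rewrite -(opprB x b) [in RHS]exprNn exprD -mulrA.
  by rewrite [in LHS](mulrCA (_ ^+ m2.+1)).
rewrite exprD -mulrA.
have d0 : (0 < d)%N by rewrite subn_gt0.
have xab0 : (x - a) ^+ m2.+1 * (x - b) ^+ m2.+1 != 0.
  by rewrite mulf_neq0// expf_neq0// subr_eq0 ?(gt_eqF ax) ?(lt_eqF xb).
split=> [/(mulIf xab0)/eqP|xE].
  (* Both [x - a] and [b - x] are nonnegative and [d > 0], so equal [d]-th powers have equal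
     bases. *)
  by rewrite eqrXn2 ?subr_ge0 ?ltW// => /eqP; lra.
by congr (_ ^+ _ * _); rewrite xE; lra.
Qed.

Lemma mean_lt_powR_nat (R : realType) (m1 m2 : nat) (a b : R) :
  (m2 < m1)%N -> 0 < a -> a < b ->
  mean_lt (fun y : R => powR y (m1 + m2 + 2)%:R) m1 m2 a b = (a + b) / 2.
Proof.
move=> m21 a0 ab; have am : a < (a + b) / 2 by lra.
have mb : (a + b) / 2 < b by lra.
apply: xget_unique => [|y [/andP[ay yb]]].
  by split; [rewrite am mb | exact/mean_equation_powR_nat].
by move/mean_equation_powR_nat; apply.
Qed.

Theorem theorem6 (R : realType) (m1 m2 : nat) (p a b : R) :
  (m2 < m1)%N -> p = (m1 + m2 + 2)%N%:R -> 0 < a -> 0 < b ->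
  power_mean p m1 m2 a b = (a + b) / 2.
Proof.
move=> m21 -> a0 b0; rewrite /power_mean /mean; case: ltgtP => [ab|ba|ab].
- exact: mean_lt_powR_nat.
- by rewrite mean_lt_powR_nat// addrC.
- by rewrite ab; lra.
Qed.
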